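(* Let $q$ be a prime power and $n\ge 1$ an integer. The number of unipotent elements of $GL(n,q)$ is $q^{n(n-1)}$.
   Context: $GL(n,q)$ is the group of invertible $n\times n$ matrices over the finite field $F_q$ with $q$ elements. An element $\alpha\in GL(n,q)$ is called unipotent if all of its eigenvalues (in an algebraic closure of $F_q$) are equal to $1$. *)

(* Defs.v *)
From HB Require Import structures.
From mathcomp Require Import all_boot all_fingroup all_algebra all_field.
From mathcomp Require Import boolp.

Set Implicit Arguments.
Unset Strict Implicit.
Unset Printing Implicit Defensive.

Import GRing.Theory.
Local Open Scope ring_scope.

(* The eigenvalues are taken in K, into which F is embedded by iota; the
   intended case is K an algebraic closure of F, that is, K algebraically
   closed and integralRange iota. *)
Definition unipotent (F K : fieldType) (iota : {rmorphism F -> K}) (n : nat)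
    (A : 'M[F]_n) : Prop :=
  forall a : K, eigenvalue (map_mx iota A) a -> a = 1.

(* Main.v *)
(* An element is unipotent iff alpha - 1 is nilpotent, so one counts nilpotent
   matrices (Fine-Herstein). By Fitting's lemma every n x n matrix is conjugate
   to diag(N, B) with N nilpotent of size k and B invertible of size n - k, and
   the conjugating matrix is unique up to GL_k x GL_(n-k). Counting all matrices
   this way gives
     sum_(k <= n) |Nil_k| / |GL_k| = q^(n^2) / |GL_n|,
   and subtracting this identity for n - 1 isolates |Nil_n|, since
   |GL_n| = q^(n-1) (q^n - 1) |GL_(n-1)|. *)

Require Import Defs.
From HB Require Import structures.
From mathcomp Require Import all_boot all_fingroup all_algebra all_field.
From mathcomp Require Import boolp zify lra.

Set Implicit Arguments.
Unset Strict Implicit.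
Unset Printing Implicit Defensive.

Import GRing.Theory.

(** * Powers of matrices *)

Lemma mulmx_expr_intertwine (R : pzSemiRingType) (m n : nat)
    (P : 'M[R]_(m, n)) (A : 'M[R]_n) (D : 'M[R]_m) (k : nat) :
  (P *m A = D *m P -> P *m A ^+ k = D ^+ k *m P)%R.
Proof.
move=> PA; elim: k => [|k IH]; first by rewrite !expr0 mulmx1 mul1mx.
by rewrite exprSr -mulmxE mulmxA IH -mulmxA PA mulmxA exprSr.
Qed.

Lemma expr_block_diag (R : pzSemiRingType) (m n : nat)
    (A : 'M[R]_m) (B : 'M[R]_n) (k : nat) :
  (block_mx A 0 0 B ^+ k = block_mx (A ^+ k) 0 0 (B ^+ k))%R.
Proof.
elim: k => [|k IH]; first by rewrite !expr0; exact: scalar_mx_block.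
rewrite !exprS IH -mulmxE mulmx_block !mulmx0 !mul0mx !addr0 !add0r.
by rewrite mulmxE.
Qed.

Lemma unitmx_expr (R : comUnitRingType) (n k : nat) (A : 'M[R]_n) :
  A \in unitmx -> (A ^+ k)%R \in unitmx.
Proof.
move=> unitA; elim: k => [|k IH]; first by rewrite expr0 unitmx1.
by rewrite exprS -mulmxE unitmx_mul unitA.
Qed.

(** * Fitting decomposition of a matrix over a field *)

Section Fitting.
Variable F : fieldType.
Local Open Scope ring_scope.

(** The row spaces of the powers decrease, and once two consecutive ones agree the chain is
    constant. If none of the first [n.+1] steps were an equality, the rank would drop [n.+1] times
    from at most [n]. *)
Lemma expr_stable_image (n k : nat) (A : 'M[F]_n) :
  (A ^+ n <= A ^+ (n + k))%MS.
Proof.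
have stepS i : (A ^+ i <= A ^+ i.+1)%MS -> (A ^+ i.+1 <= A ^+ i.+2)%MS.
  by move=> Ai; rewrite exprSr [A ^+ i.+2]exprSr -!mulmxE submxMr.
have stepD i j :
    (A ^+ i <= A ^+ i.+1)%MS -> (A ^+ (i + j) <= A ^+ (i + j).+1)%MS.
  by move=> Ai; elim: j => [|j IH]; rewrite ?addn0 // addnS stepS.
suff An : (A ^+ n <= A ^+ n.+1)%MS.
  elim: k => [|k IH]; first by rewrite addn0.
  by rewrite addnS; apply: submx_trans IH (stepD _ _ An).
have sub i : (A ^+ i.+1 <= A ^+ i)%MS by rewrite exprS -mulmxE submxMl.
case: (boolP [exists i : 'I_n.+1, (A ^+ i <= A ^+ i.+1)%MS]) => [|/existsPn no].
  by case/existsP=> i /(stepD _ (n - i)%N); rewrite subnKC // -ltnS.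
have rk i : (i <= n.+1)%N -> (\rank (A ^+ i) + i <= n)%N.
  elim: i => [|i IH] lt_in; first by rewrite addn0 rank_leq_row.
  apply: leq_trans (IH (ltnW lt_in)); rewrite addnS -addSn leq_add2r.
  rewrite ltn_neqAle mxrankS // andbT (mxrank_leqif_sup (sub i)).
  exact: (no (Ordinal lt_in)).
by have := leq_trans (leq_addl _ _) (rk _ (leqnn _)); rewrite ltnn.
Qed.

(** The rows of [P] are a basis of the kernel of [A ^+ n] followed by a basis of its row space. Both
    spaces are stable under [A], which acts nilpotently on the first and invertibly on the
    second. *)
Lemma Fitting_decomposition (m1 m2 : nat) (A : 'M[F]_(m1 + m2)) :
  \rank (A ^+ (m1 + m2)) = m2 ->
  exists (P : 'M[F]_(m1 + m2)) (N : 'M[F]_m1) (B : 'M[F]_m2),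
    [/\ P \in unitmx, N ^+ m1 = 0, B \in unitmx
      & P *m A = block_mx N 0 0 B *m P].
Proof.
set n := (m1 + m2)%N => rkA.
have basis m (C : 'M[F]_n) : \rank C = m ->
    exists2 K : 'M[F]_(m, n), (K :=: C)%MS & row_free K.
  by move=> <-; exists (row_base C);
    [exact: eq_row_base | exact: row_base_free].
have [|K defK freeK] := basis m1 (kermx (A ^+ n)).
  by rewrite mxrank_ker rkA addnK.
have [|R defR freeR] := basis m2 (A ^+ n); first by [].
have KAn : K *m A ^+ n = 0 by apply/sub_kermxP; rewrite defK.
have [N KA] : exists N, K *m A = N *m K.
  apply/submxP; rewrite defK; apply/sub_kermxP.
  by rewrite -mulmxA mulmxE -exprS exprSr -mulmxE mulmxA KAn mul0mx.
have [B RA] : exists B, R *m A = B *m R.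
  apply/submxP; rewrite defR (eqmxMr A defR) mulmxE -exprSr exprS -mulmxE.
  exact: submxMl.
have N0 : N ^+ m1 = 0.
  (* [N] has size [m1], so its powers stabilise by exponent [m1]; it suffices that [N ^+ n]
     vanishes, and [N ^+ n *m K = K *m A ^+ n = 0]. *)
  apply/eqP; rewrite -submx0; apply: submx_trans (expr_stable_image m2 N) _.
  rewrite submx0; apply/eqP/(row_free_inj freeK).
  by rewrite /= mul0mx -(mulmx_expr_intertwine _ KA).
have unitB : B \in unitmx.
  (* The rank of [B] is that of [R *m A], hence of [A ^+ n.+1], which by stability equals that of
     [A ^+ n]. *)
  rewrite -row_free_unit /row_free -(mxrankMfree B freeR) -RA (eqmxMr A defR).
  rewrite mulmxE -exprSr -[X in _ == X]rkA eqn_leq !mxrankS //.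
    by rewrite -addn1; apply: expr_stable_image.
  by rewrite exprS -mulmxE submxMl.
exists (col_mx K R), N, B; split => //; last first.
  by rewrite mul_col_mx mul_block_col !mul0mx addr0 add0r KA RA.
rewrite -row_free_unit; apply: inj_row_free => v.
rewrite -[v]hsubmxK mul_row_col => vP.
(* Applying [A ^+ n] to the relation kills the kernel part and acts on the other part through the
   invertible [B ^+ n]. *)
have v2 : rsubmx v = 0.
  have /(row_free_inj freeR) : rsubmx v *m B ^+ n *m R = 0 *m R.
    have := congr1 (mulmx^~ (A ^+ n)) vP.
    rewrite mulmxDl mul0mx -!mulmxA KAn mulmx0 add0r.
    by rewrite (mulmx_expr_intertwine _ RA) mul0mx.
  move=> vB.
  by rewrite -[rsubmx v](mulmxK (unitmx_expr n unitB)) vB mul0mx.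
move: vP; rewrite v2 mul0mx addr0 -(mul0mx _ K) => /(row_free_inj freeK) ->.
by rewrite mul0mx row_mx0.
Qed.
End Fitting.

(** * Counting nilpotent matrices over a finite field *)

Section Counting.
Variable F : finFieldType.

Definition unit_count (n : nat) := #|[set A : 'M[F]_n | A \in unitmx]|.

Definition nilpotent_count (n : nat) :=
  #|[set A : 'M[F]_n | A ^+ n == 0]%R|.

(* The n-th power reaches the stable image, so this fixes the size n - r of the
   nilpotent Fitting block. *)
Definition stable_rank_count (n r : nat) :=
  #|[set A : 'M[F]_n | \rank (A ^+ n)%R == r]|.

Lemma unit_count_gt0 (n : nat) : (0 < unit_count n)%N.
Proof. by apply/card_gt0P; exists 1%:M%R; rewrite inE unitmx1. Qed.

(** Double counting of the triples [(P, (N, B))]: the map [f] sends them onto the matrices of stable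
    rank [m2], with all fibres of size [unit_count m1 * unit_count m2]. The common factor
    [unit_count m2] cancels. *)
Lemma stable_rank_countD (m1 m2 : nat) :
  (unit_count m1 * stable_rank_count (m1 + m2) m2
     = unit_count (m1 + m2) * nilpotent_count m1)%N.
Proof.
set n := (m1 + m2)%N.
apply/eqP; rewrite -(eqn_pmul2r (unit_count_gt0 m2)); apply/eqP.
pose U m := [set A : 'M[F]_m | A \in unitmx].
pose Nil := [set A : 'M[F]_m1 | A ^+ m1 == 0]%R.
pose X := [set A : 'M[F]_n | \rank (A ^+ n)%R == m2].
pose D := setX (U n) (setX Nil (U m2)).
pose f (t : 'M[F]_n * ('M[F]_m1 * 'M[F]_m2)) : 'M[F]_n :=
  (invmx t.1 *m block_mx t.2.1 0 0 t.2.2 *m t.1)%R.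
have fP P N B A : P \in unitmx ->
    (f (P, (N, B)) == A) = (P *m A == block_mx N 0 0 B *m P)%R.
  move=> uP; apply/eqP/eqP => [<-|PA]; first by rewrite /f /= -mulmxA mulKVmx.
  by rewrite /f /= -mulmxA -PA mulKmx.
transitivity #|D|; last by rewrite !cardsX mulnA.
have fD t : t \in D -> f t \in X.
  case: t => P [N B]; rewrite !inE /= => /and3P[uP /eqP N0 uB].
  have /eqP PA : (P *m f (P, (N, B)) == block_mx N 0 0 B *m P)%R by rewrite -fP.
  have fullP : row_full P by rewrite row_full_unit.
  rewrite -(eqmxMfull _ fullP) (mulmx_expr_intertwine _ PA).
  rewrite mxrankMfree ?row_free_unit // expr_block_diag rank_diag_block_mx.
  by rewrite exprD N0 mul0r mxrank0 add0n mxrank_unit // unitmx_expr.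
have fibre A : A \in X ->
    #|[set t in D | f t == A]| = (unit_count m1 * unit_count m2)%N.
  rewrite inE => /eqP/Fitting_decomposition[P [N [B [uP N0 uB PA]]]].
  (* From one decomposition of [A], the map [g] produces all others by a block diagonal change of
     basis. *)
  pose g (Q : 'M[F]_m1 * 'M[F]_m2) : 'M[F]_n * ('M[F]_m1 * 'M[F]_m2) :=
    (block_mx Q.1 0 0 Q.2 *m P,
     (Q.1 *m N *m invmx Q.1, Q.2 *m B *m invmx Q.2))%R.
  have g_inj : injective g.
    case=> [Q1 Q2] [R1 R2] [/(row_free_inj (_ : row_free P))].
    by rewrite row_free_unit => /(_ uP)/eq_block_mx[-> _ _ ->] _ _.
  rewrite -cardsX -(card_imset _ g_inj); apply: eq_card => t.
  apply/idP/imsetP => [|[[Q1 Q2]]]; last first.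
    rewrite !inE /= => /andP[uQ1 uQ2] ->.
    have uQ : block_mx Q1 0 0 Q2 \in unitmx by rewrite block_diag_mx_unit uQ1.
    have N0' : ((Q1 *m N *m invmx Q1) ^+ m1 = 0)%R.
      apply: (row_free_inj (_ : row_free Q1)); first by rewrite row_free_unit.
      rewrite /= mul0mx -(mulmx_expr_intertwine (A := N)) ?N0 ?mulmx0 //.
      by rewrite mulmxKV.
    rewrite /g fP /= ?N0' ?eqxx ?unitmx_mul ?unitmx_inv ?uQ ?uP ?uQ2 ?uB //=.
    rewrite -[X in X == _]mulmxA PA !mulmxA !mulmx_block.
    rewrite !mulmx0 !mul0mx !addr0 !add0r.
    by rewrite !mulmxKV.
  case: t => P' [N' B']; rewrite !inE -!andbA /=.
  case/and4P=> uP' /eqP N0' uB'; rewrite fP // => /eqP PA'.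
  (* The transition matrix between two decompositions of [A]; it remains to see that it is block
     diagonal. *)
  pose Q := (P' *m invmx P)%R.
  have uQ : Q \in unitmx by rewrite unitmx_mul uP' unitmx_inv.
  have QD : (Q *m block_mx N 0 0 B = block_mx N' 0 0 B' *m Q)%R.
    rewrite /Q mulmxA -PA' -!mulmxA; congr (_ *m _)%R.
    by rewrite -[LHS](mulmxK uP) -(mulmxA (invmx P)) -PA mulKmx.
  have := QD; rewrite -[Q]submxK !mulmx_block !mulmx0 !mul0mx !addr0 !add0r.
  case/eq_block_mx=> Q11 Q12 Q21 Q22.
  (* Off the diagonal Q intertwines an invertible block with a nilpotent one,
     so some power kills it. *)
  have Q12_0 : ursubmx Q = 0%R.
    rewrite -[LHS](mulmxK (unitmx_expr m1 uB)) (mulmx_expr_intertwine _ Q12).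
    by rewrite N0' !mul0mx.
  have Q21_0 : dlsubmx Q = 0%R.
    rewrite -[LHS](mulKmx (unitmx_expr m1 uB')) -(mulmx_expr_intertwine _ Q21).
    by rewrite N0 !mulmx0.
  have defQ : Q = block_mx (ulsubmx Q) 0 0 (drsubmx Q).
    by rewrite -{1}[Q]submxK Q12_0 Q21_0.
  have /andP[uQ1 uQ2] : (ulsubmx Q \in unitmx) && (drsubmx Q \in unitmx).
    by rewrite -block_diag_mx_unit -defQ.
  exists (ulsubmx Q, drsubmx Q); first by rewrite !inE uQ1.
  by rewrite /g /= -defQ /Q mulmxKV // -/Q Q11 Q22 !mulmxK.
rewrite -sum1_card (partition_big f (mem X)) //=.
rewrite (eq_bigr (fun=> (unit_count m1 * unit_count m2)%N)); last first.
  by move=> A XA; rewrite -(fibre _ XA) -sum1_card; apply: eq_bigl => t;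
    rewrite inE.
by rewrite sum_nat_const mulnCA mulnA.
Qed.

Lemma unit_countE (n : nat) :
  unit_count n = (#|F| ^ 'C(n, 2) * \prod_(1 <= i < n.+1) (#|F| ^ i - 1))%N.
Proof.
case: n => [|n]; last first.
  by rewrite -card_GL // cardsT card_sub; apply: eq_card => A; rewrite inE.
(* In size 0 the only matrix is the empty one, and it is invertible. *)
rewrite big_geq // muln1 /unit_count -(expn0 #|F|) -(card_mx F 0 0).
by apply: eq_card => A; rewrite !inE (flatmx0 A) -row_free_unit /row_free mxrank0.
Qed.

Lemma unit_countS (n : nat) :
  unit_count n.+1 = (#|F| ^ n * (#|F| ^ n.+1 - 1) * unit_count n)%N.
Proof.
rewrite !unit_countE big_nat_recr //= binS bin1 expnD.
by rewrite mulnACA mulnC.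
Qed.

Local Open Scope ring_scope.

Let gl_neq0 n : (unit_count n)%:R != 0 :> rat.
Proof. by rewrite Num.Theory.pnatr_eq0 -lt0n unit_count_gt0. Qed.

Lemma sum_nilpotent_ratio (n : nat) :
  \sum_(k < n.+1) (nilpotent_count k)%:R / (unit_count k)%:R
    = (#|F| ^ (n * n))%:R / (unit_count n)%:R :> rat.
Proof.
have -> : (#|F| ^ (n * n))%N = (\sum_(k < n.+1) stable_rank_count n (n - k))%N.
  rewrite -card_mx -sum1_card.
  (* All matrices are sorted by the size of their nilpotent block; it is at most [n], so [inord]
     does not alter it. *)
  pose corank (A : 'M[F]_n) : 'I_n.+1 := inord (n - \rank (A ^+ n)).
  rewrite (partition_big corank predT) //=; apply: eq_bigr => k _.
  rewrite /stable_rank_count -sum1_card; apply: eq_bigl => A.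
  have rkA := rank_leq_row (A ^+ n).
  rewrite inE -val_eqE /= inordK ?ltnS ?leq_subr //.
  have := ltn_ord k; rewrite ltnS => le_kn.
  by apply/eqP/eqP => [<- | ->]; rewrite subKn.
rewrite natr_sum mulr_suml; apply: eq_bigr => k _.
apply/eqP; rewrite eqr_div // -!natrM Num.Theory.eqr_nat; apply/eqP.
have := stable_rank_countD k (n - k); rewrite subnKC -1?ltnS // => E.
by rewrite mulnC -E mulnC.
Qed.

Lemma nilpotent_countE (n : nat) :
  nilpotent_count n = (#|F| ^ (n * (n - 1)))%N.
Proof.
apply/eqP; rewrite -(Num.Theory.eqr_nat rat); apply/eqP.
case: n => [|n].
  have := sum_nilpotent_ratio 0; rewrite big_ord1.
  by move/(mulIf (_ : _^-1 != 0)) => -> //; rewrite invr_eq0.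
have := sum_nilpotent_ratio n.+1; rewrite big_ord_recr /= sum_nilpotent_ratio.
(* With [q] for the order of [F], clearing denominators gives [q^(n*n) * q^n * (q^(n+1) - 1) +
   nilpotent_count n.+1 = q^((n+1)*(n+1))], which is linear in the unknown. *)
move/(congr1 ( *%R^~ (unit_count n.+1)%:R)); rewrite mulrDl !mulfVK //.
have q_gt0 : (0 < #|F| ^ n.+1)%N by rewrite expn_gt0 (ltnW (finNzRing_gt1 F)).
rewrite {1}unit_countS natrM mulrA mulrAC mulfVK // natrM natrB //.
have -> : (n.+1 * n.+1 = n * n + n + n.+1)%N by lia.
have -> : (n.+1 * (n.+1 - 1) = n * n + n)%N by lia.
rewrite !expnD !natrM => E; lra.
Qed.
End Counting.

(** * Unipotent matrices as translates of nilpotent ones *)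

Section Unipotent.
Variables (F : fieldType) (K : closedFieldType) (iota : {rmorphism F -> K}).
Local Open Scope ring_scope.

(** Subtracting the identity shifts eigenvalues by 1. If all become 0, the characteristic
    polynomial, split over [K], is a power of ['X], and Cayley-Hamilton applies. Conversely, a
    nilpotent matrix acts on an eigenvector by a nilpotent scalar. *)
Lemma unipotentE (n : nat) (A : 'M[F]_n.+1) :
  unipotent iota A <-> (A - 1) ^+ n.+1 = 0.
Proof.
set B := map_mx iota (A - 1).
have BE : B = map_mx iota A - 1 by rewrite /B map_mxB map_mx1.
have eigB a : eigenvalue (map_mx iota A) a = eigenvalue B (a - 1).
  by apply/eigenvalueP/eigenvalueP => -[v vA v0]; exists v => //; move: vA;
     rewrite BE mulmxBr mulmx1 scalerBl scale1r; [move=> -> | move/addIr].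
split=> [uA | A0 a].
  apply: (map_mx_inj (f := iota)); rewrite map_mx0 rmorphXn /= -/B.
  have [r cB] := closed_field_poly_normal (char_poly B).
  rewrite (monicP (char_poly_monic B)) scale1r in cB.
  have r0 z : z \in r -> z = 0.
    move=> zr; apply/(addIr 1); rewrite add0r; apply: uA.
    by rewrite eigB addrK eigenvalue_root_char cB root_prod_XsubC.
  have cBX : char_poly B = 'X^(n.+1).
    have /eqP := size_char_poly B; rewrite cB size_prod_XsubC eqSS => /eqP <-.
    rewrite big_seq (eq_bigr (fun=> 'X)) => [|z /r0 ->]; last by rewrite subr0.
    by rewrite -big_seq big_const_seq count_predT iter_mulr_1.
  by have := Cayley_Hamilton B; rewrite cBX rmorphXn /= horner_mx_X.
rewrite eigB => /eigenvalueP[v vB v0].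
have vBk k : v *m B ^+ k = (a - 1) ^+ k *: v.
  elim: k => [|k IH]; first by rewrite !expr0 mulmx1 scale1r.
  by rewrite exprS -mulmxE mulmxA vB -scalemxAl IH scalerA -exprS.
have := vBk n.+1; rewrite /B -rmorphXn /= A0 map_mx0 mulmx0 => /esym/eqP.
by rewrite scaler_eq0 (negPf v0) orbF expf_eq0 subr_eq0 => /andP[_ /eqP].
Qed.

(** A singular matrix has 0 as an eigenvalue, and 0 differs from 1. *)
Lemma unipotent_unitmx (n : nat) (A : 'M[F]_n) :
  unipotent iota A -> A \in unitmx.
Proof.
move=> uA; rewrite -(map_unitmx iota) -row_free_unit -kermx_eq0.
apply/negPn/negP => /rowV0Pn[v /sub_kermxP vA v0].
suff /uA/esym/eqP : eigenvalue (map_mx iota A) 0 by rewrite oner_eq0.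
by apply/eigenvalueP; exists v; rewrite // scale0r.
Qed.
End Unipotent.

Theorem corollary1 (p k q n : nat) (p_prime : prime p) (k_gt0 : (0 < k)%N)
    (q_def : q = (p ^ k)%N) (n_gt0 : (0 < n)%N)
    (F : finFieldType) (cardF : #|F| = q)
    (K : closedFieldType) (iota : {rmorphism F -> K})
    (K_alg_closure : integralRange iota) :
  #|[set alpha : {'GL_n[F]} | `[< unipotent iota (GLval alpha) >]]|
    = (q ^ (n * (n - 1)))%N.
Proof.
rewrite -cardF -nilpotent_countE; case: n n_gt0 => // n _.
(* Translation by the identity matches unipotent elements with nilpotent matrices. *)
have inj_f : injective (fun alpha : {'GL_n.+1[F]} => GLval alpha - 1)%R.
  by move=> x y /addIr/val_inj.
rewrite -(card_imset _ inj_f); apply: eq_card => N.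
apply/imsetP/idP => [[alpha] | ]; rewrite inE.
  by move/asboolP/unipotentE => a1 ->; rewrite inE a1.
move=> /eqP N0.
have uA : unipotent iota (N + 1)%R by apply/unipotentE; rewrite addrK.
exists (FinRing.Unit (unipotent_unitmx uA) : {'GL_n.+1[F]}); last first.
  by rewrite /= addrK.
by rewrite inE; apply/asboolP.
Qed.
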